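(* Let $T_1$ and $T_2$ be compact Hausdorff right topological semigroups and for $i\in\{1,2\}$ let $A_i$ be a nonempty subset of $T_i$ with $A_i\subseteq\{ab:a,b\in A_i\}$. Then $J_{T_1\times T_2}(A_1\times A_2)=J_{T_1}(A_1)\times J_{T_2}(A_2)$.
   Context: A semigroup with a topology is right topological if every right translation $x\mapsto xs$ is continuous. $T_1\times T_2$ has the product topology and coordinatewise operation. For a compact Hausdorff right topological semigroup $T$ and $A\subseteq T$, $J_T(A)$ denotes the smallest compact subsemigroup of $T$ containing $A$ (the intersection of all compact subsemigroups of $T$ containing $A$). *)

(* Defs.v *)
From HB Require Import structures.
From mathcomp Require Import all_boot.
From mathcomp Require Import boolp classical_sets functions topology.

Set Implicit Arguments.
Unset Strict Implicit.
Unset Printing Implicit Defensive.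

Local Open Scope classical_set_scope.
Local Open Scope group_scope.

HB.mixin Record isCompactHausdorffRightTopological T
    of Semigroup T & Topological T := {
  compactT : compact [set: T];
  hausdorffT : hausdorff_space T;
  continuous_mulgr : forall s : T, continuous (fun x : T => x * s)
}.

#[short(type="chrtSemigroupType")]
HB.structure Definition CHRTSemigroup :=
  {T of Semigroup T & Topological T & isCompactHausdorffRightTopological T}.

Section Product.
Variables T1 T2 : chrtSemigroupType.

(* The operation and the topology on [T1 * T2] are the canonical ones:
   [mul_pair] (coordinatewise) and the product topology. *)
Fact prod_compactT : compact [set: T1 * T2].
Proof. by rewrite -setXTT; apply: compact_setX; exact: compactT. Qed.

Fact prod_hausdorffT : hausdorff_space (T1 * T2)%type.
Proof.
move=> [p1 p2] [q1 q2] pq; congr pair.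
- apply: (@hausdorffT T1) => A B pA qB.
  have [||[x y] [/= Ax Bx]] := pq (fst @^-1` A) (fst @^-1` B).
  + by apply: (@cvg_fst _ _ (nbhs p1) (nbhs p2)).
  + by apply: (@cvg_fst _ _ (nbhs q1) (nbhs q2)).
  + by exists x.
- apply: (@hausdorffT T2) => A B pA qB.
  have [||[x y] [/= Ay By]] := pq (snd @^-1` A) (snd @^-1` B).
  + by apply: (@cvg_snd _ _ (nbhs p1) (nbhs p2)).
  + by apply: (@cvg_snd _ _ (nbhs q1) (nbhs q2)).
  + by exists y.
Qed.

Fact prod_continuous_mulgr (s : T1 * T2) :
  continuous (fun x : T1 * T2 => x * s).
Proof.
move=> x; apply: (@cvg_pair _ _ _ _ (nbhs (x.1 * s.1)) (nbhs (x.2 * s.2))).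
- apply: (@cvg_comp _ _ _ fst (fun y => y * s.1) _ (nbhs x.1)).
  + exact: cvg_fst.
  + exact: continuous_mulgr.
- apply: (@cvg_comp _ _ _ snd (fun y => y * s.2) _ (nbhs x.2)).
  + exact: cvg_snd.
  + exact: continuous_mulgr.
Qed.

HB.instance Definition _ :=
  isCompactHausdorffRightTopological.Build (T1 * T2)%type
    prod_compactT prod_hausdorffT prod_continuous_mulgr.

End Product.

Definition subsemigroup (T : semigroupType) (S : set T) : Prop :=
  forall x y : T, S x -> S y -> S (x * y).

(* [smallest C A] is the intersection of all members of [C] containing [A]. *)
Definition J (T : chrtSemigroupType) (A : set T) : set T :=
  smallest [set S : set T | compact S /\ subsemigroup S] A.

(* Main.v *)
Require Import Defs.
From mathcomp Require Import all_boot.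
From mathcomp Require Import boolp classical_sets functions topology.

(** Let [S] be a compact subsemigroup containing [A1 `*` A2].  If
    [B] is contained in the closure of [B * B], then the set of [y] such that
    [B `*` [set y]] is contained in [S] is a compact subsemigroup.  This applies
    to [B = A2] on the second factor, giving [J A1 `*` A2 `<=` S], and then to
    [B = J A1] on the first factor, giving [J A1 `*` J A2 `<=` S].  The set
    [J A1] qualifies because the closure of [J A1 * J A1] is itself a compact
    subsemigroup containing [A1]. *)

Set Implicit Arguments.
Unset Strict Implicit.
Unset Printing Implicit Defensive.

Local Open Scope classical_set_scope.
Local Open Scope group_scope.

Lemma compact_closedP (T : chrtSemigroupType) (S : set T) :
  compact S <-> closed S.
Proof.
split=> [|cS]; first exact: (compact_closed hausdorffT).
by apply: (subclosed_compact cS compactT).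
Qed.

Lemma sub_J (T : chrtSemigroupType) (A : set T) : A `<=` J A.
Proof. exact: sub_smallest. Qed.

Lemma J_sub (T : chrtSemigroupType) (A S : set T) :
  compact S -> subsemigroup S -> A `<=` S -> J A `<=` S.
Proof. by move=> cS sS AS; apply: smallest_sub. Qed.

Lemma compact_J (T : chrtSemigroupType) (A : set T) : compact (J A).
Proof.
apply/compact_closedP; apply: closed_bigI => S /= [[cS _] _].
exact/compact_closedP.
Qed.

Lemma subsemigroup_J (T : chrtSemigroupType) (A : set T) : subsemigroup (J A).
Proof.
by move=> x y Jx Jy S CS; have [[_ sS] _] := CS; apply: sS; [exact: Jx|exact: Jy].
Qed.

Lemma J_sub_closure_mul (T : chrtSemigroupType) (A : set T) :
  A `<=` [set a * b | a in A & b in A] ->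
  J A `<=` closure [set a * b | a in J A & b in J A].
Proof.
move=> AA; have sJ : closure [set a * b | a in J A & b in J A] `<=` J A.
  have /compact_closedP/closure_id JE := @compact_J _ A.
  rewrite [X in _ `<=` X]JE; apply: closureS => _ [a Ja [b Jb <-]].
  exact: subsemigroup_J.
apply: J_sub.
- exact/compact_closedP/closed_closure.
(* By [sJ] both factors already lie in [J A], so their product is in the set of products itself. No
   joint continuity of the multiplication is involved. *)
- move=> x y /sJ Jx /sJ Jy; apply: subset_closure.
  by exists x => //; exists y.
- move=> x /AA [a Aa [b Ab <-]]; apply: subset_closure.
  by exists a; [exact: sub_J|exists b; first exact: sub_J].
Qed.

Lemma J_slice_sub (T U : chrtSemigroupType) (S : set (T * U)) (B : set T)
    (A : set U) :
  closed S -> subsemigroup S -> B `<=` closure [set a * b | a in B & b in B] ->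
  B `*` A `<=` S -> B `*` J A `<=` S.
Proof.
move=> cS sS BB BAS [x y] [/= Bx JAy].
suff : J A `<=` [set y | forall x, B x -> S (x, y)] by exact.
apply: J_sub => [|y1 y2 Sy1 Sy2 z Bz|z Az w Bw]; last exact: BAS.
- have -> : [set y | forall x, B x -> S (x, y)] =
      \bigcap_(x in B) ((fun y => (x, y)) @^-1` S) by [].
  apply/compact_closedP; apply: closed_bigI => z _.
  apply: preimage_closed => // w _.
  by apply: cvg_pair; [exact: cvg_cst|exact: cvg_id].
(* For [a], [b] in [B], [(a * b, y1 * y2) = (a, y1) * (b, y2)] is in [S]. As this slice of [S] is
   closed, it also contains the limit points of such products [a * b], hence [z]. *)
- have cl : closed ((fun x : T => (x, y1 * y2)) @^-1` S).
    apply: preimage_closed => // w _.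
    by apply: cvg_pair; [exact: cvg_id|exact: cvg_cst].
  apply: cl; apply: closureS (BB _ Bz) => _ [a Ba [b Bb <-]].
  by apply: (sS (a, y1) (b, y2)); [exact: Sy1|exact: Sy2].
Qed.

Theorem theorem4p13 (T1 T2 : chrtSemigroupType) (A1 : set T1) (A2 : set T2)
    (A1_neq0 : A1 !=set0) (A2_neq0 : A2 !=set0)
    (A1_mul : A1 `<=` [set a * b | a in A1 & b in A1])
    (A2_mul : A2 `<=` [set a * b | a in A2 & b in A2]) :
  J (A1 `*` A2) = J A1 `*` J A2.
Proof.
apply/seteqP; split.
  apply: J_sub.
  - by apply: compact_setX; exact: compact_J.
  - by move=> x y [? ?] [? ?]; split; exact: subsemigroup_J.
  - by apply: setSX; exact: sub_J.
have cS : closed (J (A1 `*` A2)) by apply/compact_closedP/compact_J.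
have sS := @subsemigroup_J _ (A1 `*` A2).
(* Working backwards, the slice lemma is used first with [B = J A1]; it remains to place [J A1]*[A2]
   in the target. *)
apply: J_slice_sub => //; first exact: J_sub_closure_mul.
move=> [x y] [/= Jx Ay].
(* [J_slice_sub] enlarges only the second factor, so the coordinates are swapped to treat [A1]. *)
suff : A2 `*` J A1 `<=` [set z : T2 * T1 | J (A1 `*` A2) (z.2, z.1)].
  by move=> /(_ (y, x)); apply.
apply: J_slice_sub.
- apply: (preimage_closed (f := fun z : T2 * T1 => (z.2, z.1))) => // z _.
  by apply: cvg_pair; [exact: cvg_snd|exact: cvg_fst].
- by move=> z w; exact: sS.
- exact: subset_trans A2_mul (@subset_closure _ _).
- by move=> z [? ?]; exact: sub_J.
Qed.
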